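(* Let $R=\mathbb{C}[x_1,\dots,x_N]$ be graded by a finitely generated abelian group $M$ via $\deg(x_i)=d_i\in M$, with $\dim_{\mathbb{C}}(R_0)=1$. Let $m\in M$ and let $g\in R_m$ be nonzero. Then there is a linear function $\Psi_g:D_0\to D_0$ such that $\Phi_g\circ\Psi_g$ is the identity map on $D_0$.
   Context: Grading: given $d_1,\dots,d_N\in M$, set $\deg(x^\alpha)=\sum_{i=1}^N\alpha_i d_i\in M$ for $\alpha\in(\mathbb{Z}_{\ge 0})^N$, and for $m\in M$ let $R_m=\mathrm{span}_{\mathbb{C}}\{x^\alpha : \deg(x^\alpha)=m\}$, so $R=\bigoplus_{m\in M}R_m$. For $g\in R_m$ write $\deg g=m$. Standing assumption: $\dim_{\mathbb{C}}(R_0)=1$, i.e. $R_0=\mathbb{C}$ (equivalently $\dim_{\mathbb{C}} R_m<\infty$ for all $m\in M$). Dual space: for $\alpha\in(\mathbb{Z}_{\ge 0})^N$ let $\partial_\alpha:R\to\mathbb{C}$ be the linear functional $\partial_\alpha(g)=\frac{1}{\alpha!}\frac{\partial^{|\alpha|}g}{\partial x_1^{\alpha_1}\cdots\partial x_N^{\alpha_N}}\Big|_{x=0}$, where $\alpha!=\prod_i\alpha_i!$ and $|\alpha|=\sum_i\alpha_i$ (i.e. the coefficient of $x^\alpha$ in $g$). Let $D_0=\mathrm{span}_{\mathbb{C}}\{\partial_\alpha:\alpha\in(\mathbb{Z}_{\ge 0})^N\}$ (finite linear combinations). For $M$-homogeneous $g$, the linear operator $\Phi_g:D_0\to D_0$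 is defined by $\Phi_g(\partial)(f)=\partial(gf)$ for all $f\in R$; equivalently $\Phi_g(\partial_\alpha)=\sum_{\gamma:\ \deg(x^\gamma)=\deg g}\partial_\gamma(g)\,\partial_{\alpha-\gamma}$, with $\partial_{\alpha-\gamma}=0$ if $\alpha-\gamma\notin(\mathbb{Z}_{\ge 0})^N$. *)

(* Defs.v *)
From HB Require Import structures.
From mathcomp Require Import all_boot all_order all_algebra.
From mathcomp Require Import boolp classical_sets functions reals.
From mathcomp Require Import complex mpoly.

Set Implicit Arguments.
Unset Strict Implicit.
Unset Printing Implicit Defensive.

Import Order.TTheory GRing.Theory Num.Theory.

Local Open Scope classical_set_scope.
Local Open Scope ring_scope.

Definition finitely_generated (M : zmodType) : Prop :=
  exists (k : nat) (s : 'I_k -> M),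
    forall x : M, exists c : 'I_k -> int, x = \sum_(i < k) s i *~ c i.

Section Span.
Context {K : fieldType} {V : lmodType K}.

Definition linear_span (A : set V) : set V :=
  [set v | exists (n : nat) (c : 'I_n -> K) (w : 'I_n -> V),
     (forall i, A (w i)) /\ v = \sum_(i < n) c i *: w i].

Definition has_dim (S : set V) (n : nat) : Prop :=
  exists b : 'I_n -> V,
    (forall c : 'I_n -> K, \sum_(i < n) c i *: b i = 0 -> forall i, c i = 0) /\
    linear_span (range b) = S.

Lemma linear_span0 (A : set V) : linear_span A 0.
Proof.
exists 0%N, (fun=> 0), (fun=> 0); split; first by case.
by rewrite big_ord0.
Qed.

Lemma linear_spanD (A : set V) (u v : V) :
  linear_span A u -> linear_span A v -> linear_span A (u + v).
Proof.
move=> [n1 [c1 [w1 [A1 ->]]]] [n2 [c2 [w2 [A2 ->]]]].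
exists (n1 + n2)%N,
  (fun i => match fintype.split i with inl j => c1 j | inr j => c2 j end),
  (fun i => match fintype.split i with inl j => w1 j | inr j => w2 j end).
split; first by move=> i; case: (fintype.split i).
rewrite big_split_ord /=; congr (_ + _); apply: eq_bigr => i _.
  by rewrite (unsplitK (inl i)).
by rewrite (unsplitK (inr i)).
Qed.

Lemma linear_spanZ (A : set V) (a : K) (v : V) :
  linear_span A v -> linear_span A (a *: v).
Proof.
move=> [n [c [w [Aw ->]]]]; exists n, (fun i => a * c i), w; split=> //.
by rewrite scaler_sumr; apply: eq_bigr => i _; rewrite scalerA.
Qed.

Lemma linear_span_sum (A : set V) (I : Type) (r : seq I) (P : pred I)
    (F : I -> V) :
  (forall i, P i -> linear_span A (F i)) ->
  linear_span A (\sum_(i <- r | P i) F i).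
Proof.
move=> AF; apply: (big_ind (linear_span A)) => //.
- exact: linear_span0.
- exact: linear_spanD.
Qed.

Lemma sub_linear_span (A : set V) (v : V) : A v -> linear_span A v.
Proof.
move=> Av; exists 1%N, (fun=> 1), (fun=> v); split=> //.
by rewrite big_ord1 scale1r.
Qed.

End Span.

Section Grading.
Context (K : fieldType) (N : nat) (M : zmodType) (d : 'I_N -> M).

Definition monomial_deg (a : 'X_{1..N}) : M := \sum_(i < N) d i *+ a i.

Definition graded_piece (m : M) : set {mpoly K[N]} :=
  linear_span [set 'X_[a] | a in [set a | monomial_deg a = m]].

End Grading.

Arguments graded_piece K {N M} d m.

Section DualSpace.
Context (K : numFieldType) (N : nat).

Definition dpartial (a : 'X_{1..N}) : {mpoly K[N]} -> K^o :=
  fun g => (\prod_(i < N) (a i)`!)%:R^-1 * (g^`M[a]).@[fun=> 0].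

Lemma dpartialE (a : 'X_{1..N}) (g : {mpoly K[N]}) : dpartial a g = g@_a.
Proof.
have ev0 (p : {mpoly K[N]}) : p.@[fun=> 0] = p@_0%MM.
  rewrite mevalE [in RHS](mpolyE p) raddf_sum /=; apply: eq_bigr => k _.
  rewrite mcoeffZ mcoeffX; congr (_ * _).
  have [->|] := eqVneq k 0%MM.
    by rewrite big1 // => i _; rewrite mnm0E expr0.
  move=> k0; have [i ki] : exists i, k i != 0%N.
    apply/existsP; apply: contraR k0 => /existsPn kE.
    by apply/eqP/mnmP => i; rewrite mnm0E; apply/eqP; rewrite -[_ == _]negbK kE.
  by rewrite (bigD1 i) //= expr0n (negbTE ki) mul0r.
rewrite /dpartial ev0 mcoeff_mderivm addm0 -[X in _ * X]mulr_natl mulrA.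
rewrite [X in _ * X%:R](eq_bigr (fun i => (a i)`!)) => [|i _]; last first.
  by rewrite ffactnn.
rewrite mulVf ?mul1r // pnatr_eq0 -lt0n prodn_gt0 // => i.
exact: fact_gt0.
Qed.

(* The span is taken in the K-space of all functions from polynomials to K;
   its elements are automatically linear functionals, see D0_fun_scalar. *)
Definition D0_pred : {pred {mpoly K[N]} -> K^o} :=
  [pred f | `[< linear_span (range dpartial) f >]].

Lemma D0_pred_submod_closed : submod_closed D0_pred.
Proof.
split; first by apply/asboolP; exact: linear_span0.
move=> a u v /asboolP uD /asboolP vD; apply/asboolP.
by apply: linear_spanD => //; exact: linear_spanZ.
Qed.

HB.instance Definition _ :=
  GRing.isSubmodClosed.Build K ({mpoly K[N]} -> K^o) D0_pred
    D0_pred_submod_closed.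

Record D0 : Type := MkD0 {
  D0_fun :> {mpoly K[N]} -> K^o;
  D0_funP : D0_fun \in D0_pred
}.

HB.instance Definition _ := [isSub for D0_fun].
HB.instance Definition _ := [Choice of D0 by <:].
HB.instance Definition _ := [SubChoice_isSubLmodule of D0 by <:].

Lemma D0_fun_scalar (p : D0) : scalar (p : {mpoly K[N]} -> K^o).
Proof.
case: p => p /= /asboolP[n [c [w [wD ->]]]] a f g.
rewrite !fct_sumE mulr_sumr -big_split /=; apply: eq_bigr => i _.
have [b _ <-] := wD i.
have E x : (c i *: dpartial b) x = c i * dpartial b x by [].
by rewrite !E !dpartialE mcoeffD mcoeffZ mulrDr mulrCA.
Qed.

HB.instance Definition _ (p : D0) :=
  GRing.isLinear.Build K {mpoly K[N]} K *%R (D0_fun p) (D0_fun_scalar p).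

Lemma dpartialM (a : 'X_{1..N}) (g : {mpoly K[N]}) :
  (fun f => dpartial a (g * f)) =
  \sum_(b <- msupp g | (b <= a)%MM) dpartial b g *: dpartial (a - b)%MM.
Proof.
apply/funext => f; rewrite fct_sumE dpartialE {1}(mpolyE g) mulr_suml raddf_sum.
rewrite [RHS]big_mkcond /=; apply: eq_bigr => b _.
rewrite -scalerAl mcoeffZ ['X_[b] * f]mulrC.
case: ifPn => ba.
  have -> : (dpartial b g *: dpartial (a - b)%MM) f = g@_b * f@_(a - b)%MM.
    by rewrite -!dpartialE.
  by congr (_ * _); rewrite -{1}(submK ba) addmC mcoeffMX.
rewrite [X in _ * X](_ : _ = 0) ?mulr0 //; apply: memN_msupp_eq0.
rewrite (perm_mem (msuppMX _ _)); apply/mapP => -[e _ aE]; move/negP: ba; apply.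
by rewrite aE lem_addr.
Qed.

Lemma Phi_subproof (g : {mpoly K[N]}) (p : D0) :
  (fun f => p (g * f)) \in D0_pred.
Proof.
case: p => p /= /asboolP[n [c [w [wD ->]]]]; apply/asboolP.
rewrite (_ : (fun _ => _) = \sum_(i < n) c i *: (fun f => w i (g * f))); last first.
  by apply/funext => f; rewrite !fct_sumE.
apply: linear_span_sum => i _; apply: linear_spanZ; have [a _ <-] := wD i.
rewrite dpartialM; apply: linear_span_sum => b _; apply: linear_spanZ.
by apply: sub_linear_span; exists (a - b)%MM.
Qed.

(* Defined for every g; no homogeneity is needed for D0 to be stable. *)
Definition Phi (g : {mpoly K[N]}) (p : D0) : D0 := MkD0 (Phi_subproof g p).

Lemma Phi_linear (g : {mpoly K[N]}) : linear (Phi g).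
Proof. by move=> a p q; apply: val_inj. Qed.

HB.instance Definition _ (g : {mpoly K[N]}) :=
  GRing.isLinear.Build K D0 D0 *:%R (Phi g) (Phi_linear g).

End DualSpace.

(* Main.v *)
Require Import Defs.
From HB Require Import structures.
From mathcomp Require Import all_boot all_order all_algebra.
From mathcomp Require Import boolp classical_sets functions reals.
From mathcomp Require Import complex ssrcomplements mpoly.

Import Order.TTheory GRing.Theory Num.Theory.

Local Open Scope ring_scope.

(** Let [e] be the smallest exponent of [g] for the degree-lexicographic
    well-order. Then [Phi g] maps [∂_(a + e)] to [g_e ∂_a] plus a combination of
    [∂_c] with [c < a], so by well-founded induction every [∂_a] lies in the
    image of [Phi g]. As the [∂_a] form a basis of [D0], choosing preimages and
    extending linearly gives the right inverse. *)

(** This extends [h] linearly from monomials to polynomials. The supports of [p], [q] and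
    [c *: p + q] may differ, so the three sums are first rewritten over all exponents of degree
    below a common bound [k]; the added terms have coefficient zero. *)
Lemma mcoeff_lincomb_linear (K : nzRingType) (N : nat) (V : lmodType K)
    (h : 'X_{1..N} -> V) :
  linear (fun q : {mpoly K[N]} => \sum_(b <- msupp q) q@_b *: h b).
Proof.
have bounded k (q : {mpoly K[N]}) : (msize q <= k)%N ->
    \sum_(b <- msupp q) q@_b *: h b = \sum_(b : 'X_{1..N < k}) q@_b *: h b.
  move=> qk; pose I : subFinType _ := 'X_{1..N < k}.
  rewrite (big_mksub I) /=; first last.
  - by move=> b /msize_mdeg_lt /leq_trans; apply.
  - exact: msupp_uniq.
  by rewrite big_rmcond //= => i /memN_msupp_eq0 ->; rewrite scale0r.
move=> c p q; pose k := maxn (msize (c *: p + q)) (maxn (msize p) (msize q)).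
rewrite !(bounded k) ?leq_max ?leqnn ?orbT // scaler_sumr -big_split /=.
by apply: eq_bigr => b _; rewrite mcoeffD mcoeffZ scalerDl scalerA.
Qed.

Section DualSpace.
Context {K : numFieldType} {N : nat}.
Implicit Types (a b : 'X_{1..N}) (f g : {mpoly K[N]}) (p : D0 K N).

Lemma dpartial_D0 a : dpartial a \in @D0_pred K N.
Proof. by apply/asboolP/sub_linear_span; exists a. Qed.

Definition D0_basis a : D0 K N := MkD0 (dpartial_D0 a).

Lemma D0_sumE (I : Type) (r : seq I) (P : pred I) (F : I -> D0 K N) f :
  (\sum_(i <- r | P i) F i) f = \sum_(i <- r | P i) F i f.
Proof. by apply: (big_morph (fun p : D0 K N => p f)). Qed.

Lemma D0_eq_mpolyX (p q : D0 K N) : (forall a, p 'X_[a] = q 'X_[a]) -> p = q.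
Proof.
move=> pq; apply/val_inj/funext => f /=.
rewrite (mpolyE f) !linear_sum; apply: eq_bigr => a _.
by rewrite !linearZ /= pq.
Qed.

Lemma D0_basisX a b : D0_basis a 'X_[b] = (b == a)%:R.
Proof. by rewrite /= dpartialE mcoeffX. Qed.

(** Since $\partial_b(x^a)=\delta_{ab}$, evaluation at monomials recovers the coordinates. This is
    the linear independence of the $\partial_b$. *)
Lemma D0_lincombX (q : {mpoly K[N]}) a :
  (\sum_(b <- msupp q) q@_b *: D0_basis b) 'X_[a] = q@_a.
Proof.
rewrite D0_sumE -[RHS]/(mcoeff a q) [in RHS](mpolyE q) raddf_sum /=.
apply: eq_bigr => b _; by rewrite mcoeffZ mcoeffX eq_sym -D0_basisX.
Qed.

(** The polynomial [q] encodes the finitely many coordinates of [p] in the basis $\partial_b$. *)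
Lemma D0_lincomb p :
  exists q : {mpoly K[N]}, p = \sum_(b <- msupp q) q@_b *: D0_basis b.
Proof.
have [q qp] : exists q : {mpoly K[N]}, forall a, q@_a = p 'X_[a].
  case: p => p /= /asboolP[n [c [w [wD ->]]]].
  have /choice[b bw] i : exists b, w i = dpartial b.
    by have [b _ <-] := wD i; exists b.
  (* Replace each $\partial_b$ by $x^b$: the value $\partial_b(x^a)$ is symmetric in $a$ and $b$, so
     it is also the coefficient of $x^a$ in $x^b$. *)
  exists (\sum_(i < n) c i *: 'X_[b i]) => a.
  rewrite fct_sumE raddf_sum /=; apply: eq_bigr => i _.
  by rewrite mcoeffZ mcoeffX bw eq_sym -mcoeffX -dpartialE.
by exists q; apply: D0_eq_mpolyX => a; rewrite D0_lincombX qp.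
Qed.

Lemma Phi_basis g a : Phi g (D0_basis a) =
  \sum_(b <- msupp g | (b <= a)%MM) g@_b *: D0_basis (a - b)%MM.
Proof.
apply/val_inj/funext => f /=; rewrite D0_sumE.
have /(congr1 (fun F => F f)) /= -> := dpartialM a g.
by rewrite fct_sumE; apply: eq_bigr => b _; rewrite dpartialE.
Qed.

Lemma Phi_onto_basis g : g != 0 -> forall a, exists p, Phi g p = D0_basis a.
Proof.
move=> g0; elim/(@ltmwf N) => a IH; pose e := mlast g.
have ge : g@_e != 0 by rewrite -mcoeff_msupp mlast_supp.
(* The image of [Phi g] is a subspace, so it is enough to reach each term with $b\neq e$
   separately. *)
have [q qE] : exists q, Phi g q = \sum_(b <- msupp g | (b <= a + e)%MM && (b != e))
    g@_b *: D0_basis (a + e - b)%MM.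
  rewrite big_seq_cond; apply: (big_ind (fun v => exists q, Phi g q = v)).
  - by exists 0; rewrite linear0.
  - by move=> _ _ [q1 <-] [q2 <-]; exists (q1 + q2); rewrite linearD.
  - move=> b /and3P[bg ba be].
    have [|q <-] := IH (a + e - b)%MM; last first.
      by exists (g@_b *: q); rewrite linearZ.
    (* Adding $b$ to both sides reduces $a+e-b<a$ to $e<b$, which holds because $e$ is minimal in
       the support. *)
    rewrite -(ltmc_add2l _ _ b) submK // ltmc_add2r lt_neqAle eq_sym be.
    exact: mlast_lemc.
(* Solve $\Phi_g(\partial_{a+e})=g_e\partial_a+\Phi_g(q)$ for $\partial_a$. *)
exists ((g@_e)^-1 *: (D0_basis (a + e)%MM - q)).
rewrite linearZ linearB /= qE Phi_basis.
rewrite -big_filter (bigD1_seq e) ?filter_uniq ?mem_filter ?lem_addl ?mlast_supp //=.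
rewrite big_filter_cond -qE addrK (addmK e a).
by rewrite scalerA mulVf // scale1r.
Qed.

Lemma Phi_right_inverse g : g != 0 ->
  exists Psi : {linear D0 K N -> D0 K N}, Phi g \o Psi =1 id.
Proof.
move=> g0; have [h hE] := choice (Phi_onto_basis g g0).
have [r rE] := choice D0_lincomb.
(* Although [r] comes from choice, its coefficients are forced to be the values of [p] at monomials,
   hence are linear in [p]. *)
have r_lin : linear r.
  move=> c p q; apply/mpolyP => a.
  by rewrite mcoeffD mcoeffZ -!D0_lincombX -!rE.
pose Psi p := \sum_(b <- msupp (r p)) (r p)@_b *: h b.
have Psi_lin : linear Psi.
  by move=> c p q; rewrite /Psi r_lin; apply: mcoeff_lincomb_linear.
pose Psi_isLinear := GRing.isLinear.Build K (D0 K N) (D0 K N) *:%R Psi Psi_lin.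
pose PsiL : {linear D0 K N -> D0 K N} := HB.pack Psi Psi_isLinear.
exists PsiL => p /=; rewrite /Psi linear_sum [RHS]rE; apply: eq_bigr => b _.
by rewrite linearZ /= hE.
Qed.

End DualSpace.

Theorem lemma4p7 (R : realType) (N : nat) (M : zmodType)
    (M_fg : finitely_generated M) (d : 'I_N -> M)
    (dim_R0 : has_dim (graded_piece R[i] d 0) 1)
    (m : M) (g : {mpoly R[i][N]})
    (g_homog : graded_piece R[i] d m g) (g_neq0 : g != 0) :
  exists Psi : {linear D0 R[i] N -> D0 R[i] N}, Phi g \o Psi =1 id.
Proof. exact: Phi_right_inverse. Qed.
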